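(* Let $\Omega$ be a bounded domain in $\mathbb{R}^k$, $k\ge2$, and let $F\colon\Omega\to[0,\infty]$ be a nonnegative upper semicontinuous function such that $m(\{x\in\Omega:F(x)>s\})>0$ for all $s$, and $$\int_\Omega[\log^+F(x)]^{k-1+\varepsilon}\,dx<\infty$$ for some $\varepsilon>0$. Let $\mathcal{C}_F$ be the class of all subharmonic functions $u$ on $\Omega$ such that $u\le F$, and set $M(x):=\sup\{u(x):u\in\mathcal{C}_F\}$. Fix a constant $a>1$, and let $D>0$ and a positive integer $\lambda$ be so large that $$\frac{a}{D^kS_1}+\frac1{a^\lambda}\le1.$$ Let $\varphi(t)=\delta(t)\psi(t)$, $t\in(\lambda+1,\infty)$, with $\delta$ and $\psi$ (depending on $F,a,\varepsilon,\lambda$) defined in the context. Then for all $x\in\Omega$, $$M(x)\le a^{\varphi^-(D^{-1}\operatorname{dist}(x,\partial\Omega))}.$$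
   Context: $m$ is Lebesgue measure in $\mathbb{R}^k$ and $S_1$ is the volume of the unit ball of $\mathbb{R}^k$. Subharmonic functions are allowed to take the value $-\infty$. Let $f(s)=m(\{x\in\Omega:F(x)>s\})$ be the distribution function of $F$ and $f_1(t)=f(a^t)$, $t>0$. For $t\in(\lambda+1,\infty)$, $$\delta(t)=(\lambda+1)\Big(\frac{k-1}{\varepsilon}\Big)^{\frac{k-1}{k}}\frac{1}{(t-1-\lambda)^{\varepsilon/k}},$$ $$\psi(t)=\Big[\int_{(t-\lambda)^{k-1+\varepsilon}}^\infty f_1\big(s^{\frac1{k-1+\varepsilon}}\big)\,ds+(t-\lambda)^{k-1+\varepsilon}f_1(t-\lambda)\Big]^{1/k}.$$ Under the stated assumptions $\varphi=\delta\psi\colon(\lambda+1,\infty)\to(0,\infty)$ is strictly decreasing and right-continuous, with limit $\infty$ at $(\lambda+1)^+$ and limit $0$ at $\infty$, and one puts $$\varphi^-(s)=\inf\{t\in(\lambda+1,\infty):\ \varphi(t)\le s\},\qquad s\in(0,\infty).$$ *)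

(* Defs.v *)
From HB Require Import structures.
From mathcomp Require Import all_boot all_order all_algebra.
From mathcomp Require Import all_classical all_reals all_analysis.
From mathcomp Require Import measurable_realfun.

Set Implicit Arguments.
Unset Strict Implicit.
Unset Printing Implicit Defensive.

Import Order.TTheory GRing.Theory Num.Theory.
Import numFieldNormedType.Exports.

Local Open Scope classical_set_scope.
Local Open Scope ring_scope.

(* 'rV[R]_k with its Borel sigma-algebra. *)
Definition borelV (R : realType) (k : nat) :=
  g_sigma_algebraType (@open 'rV[R]_k).

Section borelV_measurability.
Context {R : realType}.

Lemma open_borelV k (U : set 'rV[R]_k) :
  open U -> measurable (U : set (borelV R k)).
Proof. exact: sub_sigma_algebra. Qed.

Lemma measurable_coord k (i : 'I_k) :
  measurable_fun setT (fun x : borelV R k => x ord0 i : measurableTypeR R).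
Proof.
apply: (measurability _ (RGenOInfty.measurableE R)).
move=> _ [_ [a ->] <-]; rewrite setTI.
apply: open_borelV; apply: (@open_comp 'rV[R]_k R); last exact: interval_open.
by move=> x _; exact: coord_continuous.
Qed.

Lemma measurable_fun_borelV d (T : measurableType d) k (f : T -> borelV R k) :
  (forall i, measurable_fun setT (fun t => f t ord0 i : measurableTypeR R)) ->
  measurable_fun setT f.
Proof.
move=> mf; apply: (@measurability _ _ T (borelV R k) setT f (@open 'rV[R]_k)) => //.
move=> _ [U oU <-]; rewrite setTI.
pose c (q : 'rV[rat]_k) : 'rV[R]_k := map_mx ratr q.
pose P (p : 'rV[rat]_k * nat) := ball (c p.1) p.2.+1%:R^-1 `<=` U.
have -> : f @^-1` U = \bigcup_p
    (if `[< P p >] then f @^-1` (ball (c p.1) p.2.+1%:R^-1) else set0).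
  apply/seteqP; split=> [t /= Uft|t [p _]]; last first.
    by case: asboolP => // Pp tp; exact: Pp.
  have /nbhs_ballP[e /= e0 eU] : nbhs (f t : 'rV[R]_k) U by exact: open_nbhs_nbhs.
  have [n ne] : exists n, n.+1%:R^-1 < e / 2 :> R.
    have [N _ /(_ N (leqnn N)) ?] :=
      near_infty_natSinv_lt (PosNum (divr_gt0 e0 (ltr0n R 2))).
    by exists N.
  have n0 : 0 < n.+1%:R^-1 :> R by rewrite invr_gt0.
  have /choice[q qE] : forall i : 'I_k, exists q : rat,
      `|ratr q - f t ord0 i : R| < n.+1%:R^-1.
    move=> i; have : f t ord0 i - n.+1%:R^-1 < f t ord0 i + n.+1%:R^-1.
      by rewrite ltrD2l gtrN.
    by move=> /rat_in_itvoo[q /itvP qi]; exists q; rewrite ltr_distl !qi.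
  exists (\row_i q i, n) => //; case: asboolP => [_|[]]/=.
    by split=> // i j; rewrite !mxE (ord1 i); exact: qE.
  move=> y [_ yq]; apply: eU; split=> // i j; rewrite (ord1 i).
  have := yq ord0 j; rewrite !mxE => /= yqj.
  rewrite /ball/= (splitr e) (le_lt_trans (ler_distD (ratr (q j)) _ _))//.
  rewrite ltrD//; last exact: lt_trans yqj ne.
  by rewrite distrC (lt_trans (qE j)).
apply: countable_bigcupT_measurable => [|p]; first exact: countableP.
case: asboolP => // _.
rewrite (_ : _ @^-1` _ = \bigcap_(i in [set: 'I_k])
    ((fun t => f t ord0 i) @^-1` ball (c p.1 ord0 i) p.2.+1%:R^-1)).
  apply: fin_bigcap_measurable => [|i _]; first exact: finite_finset.
  by rewrite -[X in measurable X]setTI; apply: mf => //; exact: measurable_ball.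
apply/seteqP; split=> [t [_ ft] i _|t ft]; first exact: ft.
by split=> [|i j]; [rewrite invr_gt0|rewrite (ord1 i); exact: ft].
Qed.

End borelV_measurability.

Section lebesgueV_succ.
Context {R : realType} (k : nat).
Variable mu : {sigma_finite_measure set (borelV R k) -> \bar R}.

Definition consV (p : measurableTypeR R * borelV R k) : borelV R k.+1 :=
  row_mx (const_mx p.1 : 'rV_1) p.2.

Definition tailV (v : borelV R k.+1) : borelV R k :=
  @rsubmx R 1 1 k v.

Lemma consV_head p : consV p ord0 ord0 = p.1.
Proof.
transitivity (consV p ord0 (lshift k ord0 : 'I_(1 + k))).
  by congr (consV p _ _); exact/val_inj.
by rewrite /consV [LHS](@row_mxEl R 1 1 k) mxE.
Qed.

Lemma consV_tail p j : consV p ord0 (rshift 1 j) = p.2 ord0 j.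
Proof. by rewrite /consV [LHS](@row_mxEr R 1 1 k). Qed.

Lemma tailV_consV p : tailV (consV p) = p.2.
Proof. by rewrite /tailV /consV row_mxKr. Qed.

Lemma measurable_consV : measurable_fun setT consV.
Proof.
apply: measurable_fun_borelV => i.
case: (@split_ordP 1 k i) => j ->.
  rewrite (_ : (fun _ => _) = fst)//; apply/funext => p.
  by rewrite -[RHS]consV_head; congr (consV p _ _); rewrite (ord1 j); exact/val_inj.
rewrite (_ : (fun _ => _) = (fun v : borelV R k => v ord0 j) \o snd).
  by apply: measurableT_comp => //; exact: measurable_coord.
by apply/funext => p; exact: consV_tail.
Qed.

Lemma measurable_tailV : measurable_fun setT tailV.
Proof.
apply: measurable_fun_borelV => i.
rewrite (_ : (fun _ => _) = (fun v : borelV R k.+1 => v ord0 (rshift 1 i))).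
  exact: measurable_coord.
by apply/funext => p; rewrite /tailV mxE.
Qed.

Definition lebesgueV_succ : set (borelV R k.+1) -> \bar R :=
  pushforward (lebesgue_measure \x mu)%E consV.

Let lebesgueV_succ0 : lebesgueV_succ set0 = 0%E.
Proof. by rewrite /lebesgueV_succ /pushforward preimage_set0 measure0. Qed.

Let lebesgueV_succ_ge0 A : (0 <= lebesgueV_succ A)%E.
Proof. by rewrite /lebesgueV_succ /pushforward; exact: measure_ge0. Qed.

Let lebesgueV_succ_sigma_additive : semi_sigma_additive lebesgueV_succ.
Proof.
move=> F mF tF mUF; rewrite /lebesgueV_succ /pushforward preimage_bigcup.
have mc B : measurable B -> measurable (consV @^-1` B).
  by move=> mB; rewrite -[X in measurable X]setTI; exact: measurable_consV.
apply: measure_semi_sigma_additive => [n| |]; first exact: mc.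
- apply/trivIsetP => /= i j _ _ ij; rewrite -preimage_setI.
  by move/trivIsetP : tF => /(_ _ _ _ _ ij) ->//; rewrite preimage_set0.
- by rewrite -preimage_bigcup; exact: mc.
Qed.

HB.instance Definition _ := isMeasure.Build _ _ _ lebesgueV_succ
  lebesgueV_succ0 lebesgueV_succ_ge0 lebesgueV_succ_sigma_additive.

Let lebesgueV_succ_sigma_finite : sigma_finite setT lebesgueV_succ.
Proof.
have /sigma_finiteP[/= F [UF ndF mF]] := sigma_finiteT (@lebesgue_measure R).
have /sigma_finiteP[/= G [UG ndG mG]] := sigma_finiteT mu.
pose hd (v : borelV R k.+1) : measurableTypeR R := v ord0 ord0.
exists (fun n => (hd @^-1` F n) `&` (tailV @^-1` G n)).
  apply/esym; rewrite -subTset => v _.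
  have [i _ Fi] : (\bigcup_i F i) (hd v) by rewrite -UF.
  have [j _ Gj] : (\bigcup_i G i) (tailV v) by rewrite -UG.
  exists (maxn i j) => //; split.
    by have /subsetPset := ndF _ _ (leq_maxl i j); exact.
  by have /subsetPset := ndG _ _ (leq_maxr i j); exact.
move=> n; split.
  apply: measurableI; rewrite -[X in measurable X]setTI.
    by apply: measurable_coord => //; exact: (mF n).1.
  by apply: measurable_tailV => //; exact: (mG n).1.
rewrite /lebesgueV_succ /pushforward (_ : _ @^-1` _ = F n `*` G n).
  rewrite product_measure1E; [|exact: (mF n).1|exact: (mG n).1].
  by apply: lte_mul_pinfty => //; [rewrite ge0_fin_numE//; exact: (mF n).2|exact: (mG n).2].
by apply/seteqP; split=> -[x v]; rewrite /= /hd tailV_consV consV_head.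
Qed.

HB.instance Definition _ := @Measure_isSigmaFinite.Build _ _ _ lebesgueV_succ
  lebesgueV_succ_sigma_finite.

End lebesgueV_succ.

(* Lebesgue measure on R^k (restricted to Borel sets), as the k-fold product of
   the one on R; cf. lebesgueV_box. *)
Fixpoint lebesgueV (R : realType) (k : nat) :
    {sigma_finite_measure set (borelV R k) -> \bar R} :=
  if k is n.+1 then lebesgueV_succ (lebesgueV R n)
  else \d_((0 : 'rV[R]_0) : borelV R 0).

Lemma lebesgueV_box (R : realType) k (A : 'I_k -> set (measurableTypeR R)) :
  (forall i, measurable (A i)) ->
  lebesgueV R k [set v : borelV R k | forall i, A i (v ord0 i)] =
  (\prod_i lebesgue_measure (A i))%E.
Proof.
elim: k A => [|k IH] A mA.
  rewrite big_ord0 /= diracE mem_set//= => i.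
  by have := ltn_ord i; rewrite ltn0.
rewrite big_ord_recl -IH//= /lebesgueV_succ /pushforward.
rewrite (_ : _ @^-1` _ = A ord0 `*`
    [set v : borelV R k | forall i, A (lift ord0 i) (v ord0 i)]).
  rewrite product_measure1E//.
  rewrite (_ : [set _ | _] = \bigcap_(i in [set: 'I_k])
      ((fun v : borelV R k => v ord0 i) @^-1` A (lift ord0 i))).
    apply: fin_bigcap_measurable => [|i _]; first exact: finite_finset.
    by rewrite -[X in measurable X]setTI; exact: measurable_coord.
  by apply/seteqP; split=> v /= h i; [move=> _|]; exact: h.
have liftE i : lift ord0 i = rshift 1 i :> 'I_(1 + k) by exact/val_inj.
apply/seteqP; split=> -[x v] /=.
  move=> h; split; first by have := h ord0; rewrite consV_head.
  by move=> i; have := h (lift ord0 i); rewrite [X in consV _ _ X]liftE consV_tail.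
move=> [Ax Av] i; case: (unliftP ord0 i) => [j ->|->]; last by rewrite consV_head.
by rewrite [X in consV _ _ X]liftE consV_tail.
Qed.

Section euclidean.
Context {R : realType} {k : nat}.
Implicit Types (x y : 'rV[R]_k) (A : set 'rV[R]_k) (r : R).

(* The library's norm `|x| on 'rV[R]_k is the sup norm. *)
Definition enorm x : R := Num.sqrt (\sum_i x ord0 i ^+ 2).

Definition eball x r : set 'rV[R]_k := [set y | enorm (y - x) < r].

Definition closed_eball x r : set 'rV[R]_k := [set y | enorm (y - x) <= r].

Definition boundary A : set 'rV[R]_k := closure A `\` A°.

Definition edist_set x A : R := inf [set enorm (x - y) | y in A].

End euclidean.

Definition unit_ball_volume (R : realType) (k : nat) : R :=
  fine (lebesgueV R k (eball 0 1)).

Definition bounded_domain (R : realType) (k : nat) (Omega : set 'rV[R]_k) :=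
  [/\ Omega !=set0, open Omega, connected Omega & bounded_set Omega].

Section subharmonic.
Context {R : realType} {k : nat}.
Variable Omega : set 'rV[R]_k.

(* Functions on Omega are total functions whose values outside Omega are
   irrelevant. *)
Implicit Types u F : 'rV[R]_k -> \bar R.

Definition usc_on u := forall x, Omega x -> forall c : R, (u x < c%:E)%E ->
  \forall y \near within Omega (nbhs x), (u y < c%:E)%E.

Definition ball_mean u x r : \bar R :=
  ((fine (lebesgueV R k (eball x r)))^-1%:E *
   \int[lebesgueV R k]_(y in eball x r) u y)%E.

(* The function identically -oo is allowed. *)
Definition subharmonic u :=
  [/\ forall x, Omega x -> u x != +oo%E,
      usc_on u &
      forall x r, 0 < r -> closed_eball x r `<=` Omega ->
        (u x <= ball_mean u x r)%E].

Definition subharmonic_minorants F : set ('rV[R]_k -> \bar R) :=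
  [set u | subharmonic u /\ forall x, Omega x -> (u x <= F x)%E].

Definition upper_envelope F x : \bar R :=
  ereal_sup [set u x | u in subharmonic_minorants F].

End subharmonic.

Definition logplus (R : realType) (y : \bar R) : \bar R := maxe (lne y) 0%E.

Section phi.
Context {R : realType} {k : nat}.
Variables (Omega : set 'rV[R]_k) (F : 'rV[R]_k -> \bar R).
Variables (a eps : R) (lam : nat).

Definition distribution_fun (s : R) : \bar R :=
  lebesgueV R k [set x | Omega x /\ (s%:E < F x)%E].

Definition f1 (t : R) : \bar R := distribution_fun (a `^ t).

Let p : R := k%:R - 1 + eps.

Definition delta (t : R) : R :=
  (lam%:R + 1) * ((k%:R - 1) / eps) `^ ((k%:R - 1) / k%:R)
  * ((t - 1 - lam%:R) `^ (eps / k%:R))^-1.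

Definition psi (t : R) : \bar R :=
  ((\int[lebesgue_measure]_(s in `[((t - lam%:R) `^ p)%R, +oo[)
      f1 (s `^ p^-1)%R
    + ((t - lam%:R) `^ p)%R%:E * f1 (t - lam%:R)%R) `^ k%:R^-1)%E.

Definition phi (t : R) : \bar R := ((delta t)%:E * psi t)%E.

(* inf is the infimum in R, with junk value 0 on sets that are empty or
   unbounded below. *)
Definition phi_inv (s : R) : R :=
  inf [set t | lam%:R + 1 < t /\ (phi t <= s%:E)%E].

End phi.

(* Main.v *)
(* Domar's argument.  If u <= F is subharmonic and u(x) >= a^t, the mean value
   inequality on a ball of radius r with
   r^k > D^k m{a^(t-lam) < u <= a^(t+1)} produces a point of that ball where
   u > a^(t+1).  Iterating, the n-th radius is about D m_n^(1/k), where
   m_n = m{a^(t+n-lam) < u <= a^(t+n+1)}.  By Hoelder's inequality with weights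
   (t+n-lam)^(k-1+eps), and because a point lies in at most lam+1 of these level
   sets, the sum of the m_n^(1/k) is at most (lam+1)^(1/k-1) phi(t) < phi(t):
   by the layer-cake formula, psi(t)^k is the integral of
   (log_a F)^(k-1+eps) over {F > a^(t-lam)}.  If D phi(t) <= dist(x, bd Omega),
   the points therefore stay in a compact part of Omega while u tends to
   infinity along them, contradicting upper semicontinuity.  Hence u(x) < a^t
   whenever phi(t) <= dist(x, bd Omega) / D. *)

Require Import Defs.
From HB Require Import structures.
From mathcomp Require Import all_boot all_order all_algebra.
From mathcomp Require Import all_classical all_reals all_analysis.
From mathcomp Require Import ring lra measurable_realfun.

Set Implicit Arguments.
Unset Strict Implicit.
Unset Printing Implicit Defensive.

Import Order.TTheory GRing.Theory Num.Theory.
Import numFieldNormedType.Exports.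

Local Open Scope classical_set_scope.
Local Open Scope ring_scope.

(** * Euclidean norm, comparison with the sup norm, boundary points on segments *)

Section euclidean_norm.
Context {R : realType} {k : nat}.
Implicit Types x y z : 'rV[R]_k.

Lemma enorm_sqr x : enorm x ^+ 2 = \sum_i x ord0 i ^+ 2.
Proof. by rewrite sqr_sqrtr// sumr_ge0// => i _; exact: sqr_ge0. Qed.

Lemma enorm_ge0 x : 0 <= enorm x.
Proof. exact: sqrtr_ge0. Qed.

Lemma enormZ (r : R) x : enorm (r *: x) = `|r| * enorm x.
Proof.
rewrite /enorm -sqrtr_sqr -sqrtrM ?sqr_ge0// mulr_sumr; congr Num.sqrt.
by apply: eq_bigr => i _; rewrite mxE exprMn.
Qed.

Lemma enormN x : enorm (- x) = enorm x.
Proof. by rewrite -scaleN1r enormZ normrN1 mul1r. Qed.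

Lemma enorm_distC x y : enorm (x - y) = enorm (y - x).
Proof. by rewrite -enormN opprB. Qed.

(** The sum of the squares of |y|^2 x_i - S y_i is nonnegative and equals |y|^2 (|x|^2 |y|^2 - S^2).
    Dividing by |y|^2 requires [y] nonzero, so the other case is treated apart. *)
Lemma cauchy_schwarz x y :
  \sum_i x ord0 i * y ord0 i <= enorm x * enorm y.
Proof.
set S := \sum_i _.
have : 0 <= \sum_i (enorm y ^+ 2 * x ord0 i - S * y ord0 i) ^+ 2.
  by apply: sumr_ge0 => i _; exact: sqr_ge0.
under eq_bigr do rewrite sqrrB !exprMn.
rewrite !big_split/= -!mulr_sumr sumrN -!enorm_sqr.
rewrite (eq_bigr (fun i => (enorm y ^+ 2 * S *+ 2) * (x ord0 i * y ord0 i))); last first.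
  by move=> i _; rewrite mulrACA mulrnAl.
rewrite -mulr_sumr -/S.
have [y0|y0] := eqVneq (enorm y) 0; last first.
  have y2 : 0 < enorm y ^+ 2 by rewrite exprn_even_gt0.
  rewrite (_ : _ + _ = enorm y ^+ 2 * ((enorm x * enorm y) ^+ 2 - S ^+ 2)); last by ring.
  rewrite pmulr_rge0// subr_ge0 => SS; apply: le_trans (ler_norm _) _.
  by rewrite -sqrtr_sqr -[leRHS]ger0_norm ?mulr_ge0 ?enorm_ge0// -sqrtr_sqr ler_wsqrtr.
have y00 i : y ord0 i = 0.
  have /eqP := enorm_sqr y; rewrite y0 expr0n eq_sym psumr_eq0; last first.
    by move=> j _; exact: sqr_ge0.
  by move=> /allP/(_ i); rewrite mem_index_enum sqrf_eq0 => /(_ isT)/eqP.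
by move=> _; rewrite y0 mulr0 /S big1// => i _; rewrite y00 mulr0.
Qed.

Lemma enormD x y : enorm (x + y) <= enorm x + enorm y.
Proof.
rewrite -(@ler_pXn2r _ 2)// ?nnegrE ?addr_ge0 ?enorm_ge0//.
rewrite sqrrD !enorm_sqr.
under eq_bigr do rewrite mxE sqrrD.
rewrite !big_split/= lerD2r lerD2l mulr2n.
by rewrite lerD ?cauchy_schwarz.
Qed.

Lemma normr_le_enorm x : `|x| <= enorm x.
Proof.
rewrite [leLHS]/Num.norm /= mx_normrE; apply/bigmax_leP; split; first exact: enorm_ge0.
move=> -[i j] _ /=; rewrite (ord1 i) -sqrtr_sqr ler_wsqrtr//.
by rewrite (bigD1 j)//= lerDl sumr_ge0// => l _; exact: sqr_ge0.
Qed.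

Lemma enorm_le_normr x : enorm x <= k%:R * `|x|.
Proof.
rewrite -[leRHS]ger0_norm// -sqrtr_sqr ler_wsqrtr//.
have h i : `|x ord0 i| <= `|x|.
  by rewrite [leRHS]/Num.norm /= mx_normrE; apply/bigmax_geP; right => /=;
    exists (ord0, i).
apply: (@le_trans _ _ (\sum_(i < k) `|x| ^+ 2)).
  by apply: ler_sum => i _; rewrite -real_normK ?num_real// lerXn2r ?nnegrE.
rewrite sumr_const card_ord -[leLHS]mulr_natl exprMn ler_wpM2r ?sqr_ge0// -natrX ler_nat.
by case: k => // n; rewrite -mulnn leq_pmull.
Qed.

Lemma continuous_enorm : continuous (enorm : 'rV[R]_k -> R).
Proof.
move=> x.
apply/(@cvgrPdist_le R R _ _ (nbhs_filter (x : 'rV[R]_k)) enorm (enorm x)) => /= e e0.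
have k0 : 0 < k%:R + 1 :> R by rewrite ltr_wpDl.
have d0 : 0 < e / (k%:R + 1) by exact: divr_gt0.
apply: filterS (nbhsx_ballx x _ d0) => y.
rewrite -ball_normE /= ltr_pdivlMr// => xy.
apply: (@le_trans _ _ (enorm (x - y))).
  have := enormD (y - x) x; have := enormD (x - y) y.
  rewrite !subrK (enorm_distC y) => h1 h2.
  by rewrite ler_norml; apply/andP; split; lra.
apply: le_trans (enorm_le_normr _) _; apply: le_trans (ltW xy).
by rewrite mulrC ler_wpM2l// lerDl.
Qed.

Lemma continuous_enorm_dist x : continuous (fun y => enorm (y - x)).
Proof.
move=> y; apply: (@continuous_comp 'rV[R]_k 'rV[R]_k R (fun y => y - x) enorm).
  have := @cvgB R 'rV[R]_k _ _ (nbhs_filter (y : 'rV[R]_k)) id (cst x) y x.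
  by apply; [exact: cvg_id|exact: cvg_cst].
exact: continuous_enorm.
Qed.

Lemma closed_closed_eball x (r : R) : closed (closed_eball x r).
Proof.
have /preimage_closed : {in ~` (fun y => enorm (y - x)) @^-1` [set s | s <= r],
    continuous (fun y => enorm (y - x))}.
  by move=> y _; exact: continuous_enorm_dist.
by apply; exact: closed_le.
Qed.

Lemma open_eball x (r : R) : open (eball x r).
Proof.
apply: (@open_comp 'rV[R]_k R _ [set s | s < r]); last exact: open_lt.
by move=> y _; exact: continuous_enorm_dist.
Qed.

Lemma compact_closed_eball x (r : R) : compact (closed_eball x r).
Proof.
apply: bounded_closed_compact; last exact: closed_closed_eball.
exists (`|x| + r); split; first exact: num_real.
move=> M rM y /= yr; rewrite -(subrK x y); apply: le_trans (ler_normD _ _) _.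
rewrite addrC; apply: le_trans (ltW rM); rewrite lerD2l.
exact: le_trans (normr_le_enorm _) yr.
Qed.

(** If the segment from [x] to [y] met no boundary point, its trace on [A] would be relatively open
    and relatively closed. Connectedness would then put the whole segment, hence [y], inside [A]. *)
Lemma segment_meets_boundary (A : set 'rV[R]_k) x y : open A -> A x -> ~ A y ->
  exists2 z, boundary A z & enorm (x - z) <= enorm (x - y).
Proof.
move=> oA Ax nAy.
pose seg (s : R) := x + s *: (y - x).
have cseg : connected (seg @` `[0, 1]).
  apply: connected_continuous_connected; first exact: segment_connected.
  apply: continuous_subspaceT => s.
  by apply: cvgD; [exact: cvg_cst|apply: cvgZr_tmp; exact: cvg_id].
apply: contrapT => /forall2NP noz.
suff : seg @` `[0, 1] `&` A = seg @` `[0, 1].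
  move/seteqP => [_ /(_ y)] [|_ //].
  by exists 1; [rewrite /= in_itv/= ler01 lexx|rewrite /seg scale1r addrC subrK].
apply: cseg.
- exists x; split=> //; exists 0; last by rewrite /seg scale0r addr0.
  by rewrite /= in_itv/= lexx ler01.
- by exists A.
- exists (closure A); first exact: closed_closure.
  apply/seteqP; split=> z [sz Az]; split=> //; first exact: subset_closure.
  apply: contrapT => nAz; case: sz => s /= s01 szE.
  have [] := noz z.
    by apply; split=> // /interior_subset.
  apply; rewrite -szE /seg opprD addNKr -scalerN enormZ opprB ger0_norm; last first.
    by move: s01; rewrite in_itv/= => /andP[].
  by move: s01; rewrite in_itv/= => /andP[_ s1]; rewrite ler_piMl ?enorm_ge0.
Qed.

End euclidean_norm.

(** * Lebesgue measure under homotheties, and volumes of balls *)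

Section lebesgueV_scaling.
Context {R : realType}.

Let measurable_affine1 (x r : R) : measurable_fun setT
  (fun s : measurableTypeR R => x + r * s : measurableTypeR R).
Proof. by apply: measurable_funD => //; exact: measurable_funM. Qed.

(** Both sides are measures in [A], so it suffices to compare them on half-open intervals, whose
    preimages have length divided by [r]. *)
Lemma lebesgue_measure_affine (x r : R) (A : set (measurableTypeR R)) :
  0 < r -> measurable A ->
  (r%:E * lebesgue_measure ((fun s => x + r * s)%R @^-1` A) = lebesgue_measure A)%E.
Proof.
move=> r0 mA.
have mf := measurable_affine1 x r.
pose nu : {measure set (measurableTypeR R) -> \bar R} :=
  measure_function_pushforward__canonical__measure_function_Measure lebesgue_measure mf.
pose mu := mscale (NngNum (ltW r0)) nu.
transitivity (mu A) => //; apply/esym.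
apply: (@lebesgue_measure_unique _ mu) => // _ [[a b]] _ <-.
transitivity (r%:E * lebesgue_measure ((fun s => (x + r * s)%R) @^-1` `]a, b]))%E => //.
rewrite (_ : _ @^-1` _ = `](r^-1 * (a - x)), (r^-1 * (b - x))]%classic); last first.
  apply/seteqP; split=> s /=; rewrite !in_itv/=;
  by rewrite ltr_pdivrMl// ler_pdivlMl// ltrBlDl lerBrDl.
rewrite !lebesgue_measure_itv/= !lte_fin ltr_pM2l ?invr_gt0// ltrD2r.
case: ifPn => ab; last by rewrite mule0.
by rewrite -!EFinB -EFinM -mulrBr mulrA mulfV ?gt_eqF// mul1r; congr EFin; ring.
Qed.

Let aff k (x : 'rV[R]_k) (r : R) (v : borelV R k) : borelV R k := x + r *: (v : 'rV[R]_k).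

Lemma measurable_affine k (x : 'rV[R]_k) (r : R) : measurable_fun setT (aff x r).
Proof.
apply: measurable_fun_borelV => i.
rewrite (_ : (fun _ => _) = (fun v : borelV R k => x ord0 i + r * v ord0 i)).
  by apply: measurable_funD => //; apply: measurable_funM => //; exact: measurable_coord.
by apply/funext => v; rewrite /aff !mxE.
Qed.

(** Induction on [k] through uniqueness of the product measure: on rectangles the head coordinate
    scales by the one-dimensional case and the tail by the induction hypothesis. *)
Lemma lebesgueV_affine k (x : 'rV[R]_k) (r : R) (A : set (borelV R k)) :
  0 < r -> measurable A ->
  ((r ^+ k)%:E * lebesgueV R k (aff x r @^-1` A) = lebesgueV R k A)%E.
Proof.
move=> r0; elim: k x A => [|k IH] x A mA.
  rewrite expr0 mul1e; congr (lebesgueV R 0 _).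
  by apply/seteqP; split=> v /=; rewrite (_ : aff x r v = v)//; apply/rowP => -[].
pose h (p : measurableTypeR R * borelV R k) : measurableTypeR R * borelV R k :=
  (x ord0 ord0 + r * p.1, aff (tailV x) r p.2).
have mh : measurable_fun setT h.
  apply: measurable_fun_pair.
    by apply: measurable_funD => //; exact: measurable_funM.
  by apply: measurableT_comp => //; exact: measurable_affine.
pose nu : {measure set (measurableTypeR R * borelV R k) -> \bar R} :=
  measure_function_pushforward__canonical__measure_function_Measure
    (lebesgue_measure \x lebesgueV R k)%E mh.
pose mu := mscale (NngNum (exprn_ge0 k.+1 (ltW r0))) nu.
have mc : measurable (@consV R k @^-1` A).
  by rewrite -[X in measurable X]setTI; exact: measurable_consV.
transitivity (mu (@consV R k @^-1` A)).
  rewrite /mu /mscale /= /lebesgueV_succ /pushforward; congr (_ * _)%E.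
  congr product_measure1; apply/seteqP.
  suff E p : aff x r (consV p) = consV (h p) by split=> p /=; rewrite E.
  apply/rowP => i; case: (@split_ordP 1 k i) => j ->.
    rewrite (ord1 j) (_ : lshift k ord0 = ord0 :> 'I_(1 + k)); last exact/val_inj.
    by rewrite [LHS]mxE [X in _ + X]mxE !consV_head.
  by rewrite [LHS]mxE [X in _ + X]mxE !consV_tail /= !mxE.
rewrite [RHS]/= /lebesgueV_succ /pushforward.
apply/esym/product_measure_unique => // B C mB mC.
transitivity ((r ^+ k.+1)%:E * (lebesgue_measure \x lebesgueV R k)
   (((fun s => (x ord0 ord0 + r * s)%R) @^-1` B) `*` (aff (tailV x) r @^-1` C)))%E => //.
rewrite product_measure1E//.
- by rewrite exprS EFinM muleACA lebesgue_measure_affine// IH.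
- rewrite -[X in measurable X]setTI; exact: measurable_affine1.
- by rewrite -[X in measurable X]setTI; exact: measurable_affine.
Qed.

Lemma measurable_eball k (x : 'rV[R]_k) r : measurable (eball x r : set (borelV R k)).
Proof. by apply: open_borelV; exact: open_eball. Qed.

Lemma lebesgueV_eball_scale k (x : 'rV[R]_k) (r : R) : 0 < r ->
  (lebesgueV R k (eball x r) = (r ^+ k)%:E * lebesgueV R k (eball 0 1))%E.
Proof.
move=> r0; rewrite -(lebesgueV_affine x r0 (measurable_eball x r)).
congr (_ * lebesgueV R k _)%E; apply/seteqP.
by split=> v /=; rewrite /eball/aff/= addrAC subrr add0r subr0 enormZ gtr0_norm//
  -{2}(mulr1 r) ltr_pM2l.
Qed.

Let box k (c : R) := [set v : borelV R k | forall i, `[- c, c]%classic (v ord0 i)].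

Let lebesgueV_cube k (c : R) : 0 < c -> lebesgueV R k (@box k c) = ((c *+ 2) ^+ k)%R%:E.
Proof.
move=> c0; rewrite /box (@lebesgueV_box R k (fun=> `[- c, c]%classic))//.
rewrite (eq_bigr (fun=> (c *+ 2)%:E)) => [|i _].
  by rewrite prodEFin prodr_const card_ord.
by rewrite lebesgue_measure_itv/= lte_fin gtrN// -EFinB opprK mulr2n.
Qed.

Let measurable_box k c : measurable (@box k c).
Proof.
rewrite (_ : @box k c = \bigcap_(i in [set: 'I_k])
    ((fun v : borelV R k => v ord0 i) @^-1` `[- c, c]%classic)).
  apply: fin_bigcap_measurable => [|i _]; first exact: finite_finset.
  by rewrite -[X in measurable X]setTI; exact: measurable_coord.
by apply/seteqP; split=> v /= h i; [move=> _|]; exact: h.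
Qed.

Let boxP k c (v : 'rV[R]_k) : 0 <= c -> @box k c v  <-> `|v| <= c.
Proof.
move=> c0; split=> [h|h i /=].
  rewrite [leLHS]/Num.norm /= mx_normrE; apply/bigmax_leP; split=> //.
  by move=> -[i j] _ /=; rewrite (ord1 i) ler_norml; have := h j; rewrite /= in_itv.
rewrite in_itv/= -ler_norml; apply: le_trans h.
by rewrite [leRHS]/Num.norm /= mx_normrE; apply/bigmax_geP; right => /=;
    exists (ord0, i).
Qed.

Lemma lebesgueV_bounded k (A : set 'rV[R]_k) : bounded_set A ->
  measurable (A : set (borelV R k)) ->
  (lebesgueV R k A < +oo)%E.
Proof.
move=> [M [Mr MA]] mA.
have M0 : 0 < `|M| + 1 by rewrite ltr_wpDl.
apply: (@le_lt_trans _ _ (lebesgueV R k (@box k (`|M| + 1)))).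
  apply: le_measure; rewrite ?inE//.
  move=> v Av; apply/boxP; first exact: ltW.
  by apply: (MA (`|M| + 1) _ v Av); rewrite ltr_pwDr// ler_norm.
by rewrite lebesgueV_cube// ltry.
Qed.

Lemma unit_ball_fin k : (lebesgueV R k (eball 0 1) < +oo)%E.
Proof.
apply: lebesgueV_bounded; last exact: measurable_eball.
exists 1; split; first exact: num_real.
move=> M M1 x /=; rewrite /eball/= subr0 => x1.
exact: le_trans (normr_le_enorm _) (ltW (lt_trans x1 M1)).
Qed.

(** Ball volumes occur as divisors, so they must not vanish. A cube of half-side 1/(k+1) fits into
    the ball, because the Euclidean norm is at most k times the sup norm. *)
Lemma unit_ball_volume_gt0 k : 0 < unit_ball_volume R k.
Proof.
rewrite fine_gt0// unit_ball_fin andbT.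
pose c : R := k.+1%:R^-1.
have c0 : 0 < c by rewrite invr_gt0.
apply: (@lt_le_trans _ _ (lebesgueV R k (@box k c))).
  by rewrite lebesgueV_cube// lte_fin exprn_gt0// pmulrn_lgt0.
apply: le_measure; rewrite ?inE//; first exact: measurable_eball.
move=> v /boxP - /(_ (ltW c0)) vc; rewrite /eball/= subr0.
apply: le_lt_trans (enorm_le_normr _) _.
apply: (@le_lt_trans _ _ (k%:R * c)); first by rewrite ler_wpM2l.
by rewrite ltr_pdivrMr// mul1r ltr_nat.
Qed.

Lemma lebesgueV_eball k (x : 'rV[R]_k) (r : R) : 0 < r ->
  lebesgueV R k (eball x r) = (r ^+ k * unit_ball_volume R k)%:E.
Proof.
move=> r0; rewrite lebesgueV_eball_scale// EFinM fineK// ge0_fin_numE//.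
exact: unit_ball_fin.
Qed.

End lebesgueV_scaling.

(** * Borel measurability of upper semicontinuous functions on an open set *)

Section usc.
Context {R : realType} {k : nat}.
Variables (Omega : set 'rV[R]_k) (u : 'rV[R]_k -> \bar R).
Hypotheses (oOmega : open Omega) (uscu : usc_on Omega u).

Lemma usc_sublevel_open (c : R) : open (Omega `&` [set y | u y < c%:E]%E).
Proof.
rewrite openE => y [Oy yc].
have := uscu Oy yc; rewrite /within /=.
have := open_nbhs_nbhs (conj oOmega Oy).
by apply: filterS2 => z Oz /(_ Oz).
Qed.

Lemma usc_measurable : measurable_fun (Omega : set (borelV R k)) u.
Proof.
move=> mO; apply: (measurability _ (ErealGenInftyO.measurableE R)) => //.
move=> _ [_ [c ->] <-]; apply: open_borelV.
rewrite (_ : _ `&` _ = Omega `&` [set y | u y < c%:E]%E); first exact: usc_sublevel_open.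
by apply/seteqP; split=> y; rewrite /= in_itv.
Qed.

End usc.

(** * The mean value inequality and level sets *)

Section mean_value.
Local Open Scope ereal_scope.
Context {R : realType} {k : nat}.
Variables (Omega : set 'rV[R]_k) (u : 'rV[R]_k -> \bar R).
Hypotheses (oOmega : open Omega) (su : subharmonic Omega u).

Definition level (c d : \bar R) : set (borelV R k) :=
  [set y | Omega y /\ (c < u y <= d)].

Lemma measurable_level c d : measurable (level c d).
Proof.
have mu : measurable_fun (Omega : set (borelV R k)) u by apply: usc_measurable; case: su.
have mO : measurable (Omega : set (borelV R k)) by exact: open_borelV.
rewrite (_ : level c d = (Omega `&` [set y | c < u y]) `&` (Omega `&` [set y | u y <= d])).
  by apply: measurableI; [exact: emeasurable_fun_o_infty|exact: emeasurable_fun_infty_c].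
by apply/seteqP; split=> y /=; rewrite /level /=;
  [move=> [Oy /andP[]]|move=> [[Oy ->] [_ ->]]].
Qed.

(** On the ball the positive part of [u] is dominated by [b] plus [c] times the indicator of the
    level set; the negative part is dropped, so only nonnegative integrals are compared. *)
Lemma ball_mean_le_levels (x : 'rV[R]_k) (r b c : R) :
  (0 < r)%R -> (0 <= b)%R -> (0 <= c)%R -> eball x r `<=` Omega ->
  (forall y, eball x r y -> u y <= c%:E) ->
  ball_mean u x r <=
    b%:E + (c / (r ^+ k * unit_ball_volume R k))%:E * lebesgueV R k (level b%:E c%:E).
Proof.
move=> r0 b0 c0 BO uc.
have V0 : (0 < r ^+ k * unit_ball_volume R k)%R.
  by rewrite mulr_gt0 ?exprn_gt0 ?unit_ball_volume_gt0.
have mB := measurable_eball x r.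
have mL := measurable_level b%:E c%:E.
have mO : measurable (Omega : set (borelV R k)) by exact: open_borelV.
have mu : measurable_fun (eball x r : set (borelV R k)) u.
  have muO := usc_measurable oOmega (let: And3 _ h _ := su in h).
  exact: (measurable_funS mO BO muO).
rewrite /ball_mean lebesgueV_eball//= lee_pdivrMl//.
rewrite muleDr ?fin_num_adde_defr// muleA -!EFinM mulrCA divff ?gt_eqF// mulr1.
rewrite integralE.
apply: (@le_trans _ _ (\int[lebesgueV R k]_(y in eball x r) u^\+ y)).
  by rewrite -[leRHS]sube0 leeB// integral_ge0.
apply: (@le_trans _ _ (\int[lebesgueV R k]_(y in eball x r)
    (b%:E + c%:E * (\1_(level b%:E c%:E) y)%:E))).
  apply: ge0_le_integral => //.
  - exact: measurable_funepos.
  - by apply: emeasurable_funD => //; apply/measurable_EFinP; apply: measurable_funM.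
  - move=> y By; rewrite funeposE ge_max; apply/andP; split; last first.
      by rewrite adde_ge0 ?lee_fin// mulr_ge0.
    have [ub|bu] := leP (u y) b%:E.
      by rewrite -[leLHS]adde0 leeD// -EFinM lee_fin mulr_ge0.
    rewrite indicE mem_set; last by split; [exact: BO|rewrite bu uc].
    by rewrite mule1 -[leLHS]add0e leeD// ?lee_fin// uc.
rewrite ge0_integralD//; last 2 first.
- by move=> y _; rewrite -EFinM lee_fin mulr_ge0.
- by apply/measurable_EFinP; apply: measurable_funM.
rewrite integral_cst// [X in b%:E * X](lebesgueV_eball x r0) -EFinM mulrC leeD2l//.
rewrite ge0_integralZl_EFin//; last exact/measurable_EFinP.
rewrite lee_wpmul2l ?lee_fin// integral_indic//.
by apply: le_measure; rewrite ?inE//; exact: measurableI.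
Qed.

(** If u <= a^(t+1) on the whole ball, the previous bound with b = a^(t-lam) and c = a^(t+1),
    together with D^k m < r^k, gives u(x) < a^t (a/(D^k S_1) + a^(-lam)) <= a^t, a contradiction. *)
Lemma subharmonic_larger_value (D a t r : R) (lam : nat) (x : 'rV[R]_k) :
  (0 < D)%R -> (1 < a)%R ->
  (a / (D ^+ k * unit_ball_volume R k) + (a ^+ lam)^-1 <= 1)%R ->
  (0 < r)%R -> closed_eball x r `<=` Omega -> (a `^ t)%:E <= u x ->
  (D ^+ k)%:E * lebesgueV R k (level (a `^ (t - lam%:R))%:E (a `^ (t + 1))%:E)
    < (r ^+ k)%:E ->
  exists2 y, eball x r y & (a `^ (t + 1))%:E < u y.
Proof.
move=> D0 a1 hD r0 BO ux ml; apply: contrapT => /forall2NP noy.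
have a0 : (0 < a)%R by exact: lt_trans a1.
have V0 := @unit_ball_volume_gt0 R k.
have BO' : eball x r `<=` Omega by move=> y /ltW; exact: BO.
have uB y : eball x r y -> u y <= (a `^ (t + 1))%:E.
  by case: (noy y) => // /negP; rewrite -leNgt.
have := ball_mean_le_levels r0 (powR_ge0 a (t - lam%:R)) (powR_ge0 a (t + 1)) BO' uB.
have [_ _ /(_ _ _ r0 BO) mv] := su; move=> /(le_trans mv) /(le_trans ux).
apply/negP; rewrite -ltNge.
set m := lebesgueV R k _ in ml *.
have m0 : 0 <= m by exact: measure_ge0.
have Dk : (0 < D ^+ k)%R by exact: exprn_gt0.
have mfin : m \is a fin_num.
  rewrite ge0_fin_numE// -(@lte_pmul2l _ (D ^+ k)%:E)// gt0_muley ?lte_fin//.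
  exact: lt_trans ml (ltry _).
rewrite -(fineK mfin) in ml *; move: (fine m) ml => {m0 mfin} {}m.
rewrite -!EFinM -EFinD !lte_fin => ml.
have an0 : (a != 0)%R by rewrite gt_eqF.
rewrite powRB ?an0 ?implybT// powRD ?an0 ?implybT// powRr1 ?ltW// powR_mulrn ?ltW//.
have at0 : (0 < a `^ t)%R by exact: powR_gt0.
apply: (@lt_le_trans _ _
  (a `^ t * (a / (D ^+ k * unit_ball_volume R k) + (a ^+ lam)^-1))%R); last first.
  by rewrite -[leRHS]mulr1 ler_pM2l.
rewrite -!mulrA -mulrDr ltr_pM2l// addrC ltrD2r ltr_pM2l//.
rewrite [ltLHS]mulrC ltr_pdivrMr ?mulr_gt0 ?exprn_gt0// invfM mulrACA.
by rewrite mulVf ?gt_eqF// mulr1 ltr_pdivlMl.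
Qed.

End mean_value.

(** * The layer-cake formula for the tail of an integral *)

Section layer_cake.
Local Open Scope ereal_scope.
Context d (T : measurableType d) {R : realType}.
Variables (mu : {sigma_finite_measure set T -> \bar R}) (D : set T) (g : T -> \bar R).
Hypotheses (mD : measurable D) (mg : measurable_fun D g).

(** Tonelli on the region c <= s < g(y): slicing at fixed s gives the first integral, slicing at
    fixed y gives the integral of g - c over the set g > c. The term c mu{g > c} restores the
    subtracted constant. *)
Lemma layer_cake_tail (c : R) : (0 <= c)%R ->
  \int[lebesgue_measure]_(s in `[c, +oo[) mu [set y | D y /\ s%:E < g y]
    + c%:E * mu [set y | D y /\ c%:E < g y]
  = \int[mu]_(y in [set y | D y /\ c%:E < g y]) g y.
Proof.
move=> c0.
pose E : set (measurableTypeR R * T) :=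
  [set p | `[c, +oo[%classic p.1 /\ D p.2 /\ p.1%:E < g p.2].
have mE : measurable E.
  rewrite (_ : E = (`[c, +oo[ `*` D) `&`
      ([set: measurableTypeR R * T] `&` [set p | p.1%:E < (g \_ D) p.2])).
    apply: measurableI; first exact: measurableX.
    apply: measurable_lte => //; first exact/measurable_EFinP.
    by apply: measurableT_comp => //; exact/(measurable_restrictT _ mD).
  apply/seteqP; split=> -[s y]; rewrite /E /=.
    by move=> [cs [Dy sg]]; do 2 split=> //; rewrite patchE mem_set.
  by move=> [[cs Dy] [_]]; rewrite patchE mem_set.
have mDc s : measurable [set y | D y /\ s%:E < g y].
  rewrite (_ : [set _ | _] = D `&` [set y | s%:E < g y])//.
  exact: emeasurable_fun_o_infty.
set B := [set y | D y /\ c%:E < g y].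
have mgB : measurable_fun B g by apply: measurable_funS mg => // y [].
transitivity (\int[mu]_(y in B) (g y - c%:E) + c%:E * mu B); last first.
  rewrite -(integral_cst mu (mDc c) c%:E) -/B.
  rewrite -[LHS](@ge0_integralD _ _ _ mu B (mDc c) (fun y => g y - c%:E) (cst c%:E))//.
  - by apply: eq_integral => y _; rewrite subeK.
  - by move=> y [_ /ltW cg]; rewrite sube_ge0.
  - exact: emeasurable_funB.
congr (_ + _).
transitivity ((lebesgue_measure \x mu) E).
  rewrite /product_measure1 integral_mkcond; apply: eq_integral => s _.
  rewrite patchE /=; case: ifPn => [/set_mem cs|/negP nc].
    congr (mu _); apply/seteqP; split=> y /=; rewrite /xsection /= inE.
      by move=> []; split.
    by move=> [_ []].
  rewrite (_ : xsection E s = set0) ?measure0//.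
  apply/seteqP; split=> // y; rewrite /xsection /= inE => -[cs _].
  by apply: nc; rewrite inE.
(* The exchange of the order of integration: the two product measures agree on rectangles, hence on
   [E]. *)
transitivity ((lebesgue_measure \x^ mu) E).
  by apply: product_measure_unique => //= ? ? ? ?; rewrite product_measure2E.
rewrite /product_measure2 [RHS]integral_mkcond; apply: eq_integral => y _.
rewrite patchE /=; case: ifPn => [/set_mem [Dy cg]|/negP nB]; last first.
  rewrite (_ : ysection E y = set0) ?measure0//.
  apply/seteqP; split=> // s; rewrite /ysection /= inE => -[/=].
  rewrite in_itv/= andbT => cs [Dy sg].
  by apply: nB; rewrite inE; split=> //; apply: le_lt_trans sg; rewrite lee_fin.
have -> : ysection E y = [set s | (c <= s)%R /\ s%:E < g y].
  apply/seteqP; split=> s; rewrite /ysection /= inE /E /= in_itv/= andbT.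
    by move=> [? []].
  by move=> [].
move: cg; case: (g y) => [r| |//] cg.
  rewrite (_ : [set _ | _] = `[c, r[%classic).
    by rewrite lebesgue_measure_itv/= cg.
  by apply/seteqP; split=> s /=; rewrite in_itv/= lte_fin => /andP.
rewrite (_ : [set _ | _] = `[c, +oo[%classic).
  by rewrite lebesgue_measure_itv/= ltry.
by apply/seteqP; split=> s /=; rewrite in_itv/= andbT ltry//; case.
Qed.

End layer_cake.

(** All selected indices lie in the window of [lam.+1] integers that starts at the least one. This
    bounds how many level sets can share a point. *)
Lemma count_close (lam N : nat) (P : pred nat) :
  (forall m n, P m -> P n -> (n <= m + lam)%N) ->
  (\sum_(n < N | P n) 1 <= lam.+1)%N.
Proof.
move=> h; rewrite sum1_card.
have [n Pn|P0] := pickP (fun n : 'I_N => P n); last by rewrite eq_card0.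
have ex : exists n, P n by exists n.
case: (ex_minnP ex) => m Pm mmin.
rewrite cardE -(size_map val) -(size_iota m lam.+1).
apply: uniq_leq_size; first by rewrite map_inj_uniq ?enum_uniq//; exact: val_inj.
move=> _ /mapP[i + ->]; rewrite mem_enum => Pi.
by rewrite mem_iota addnS ltnS mmin//= h.
Qed.

(** * Powers of the positive logarithm to base [a] *)

Section loglevel.
Local Open Scope ereal_scope.
Context {R : realType}.
Variables (a p : R).
Hypotheses (a1 : (1 < a)%R) (p0 : (0 < p)%R).

(** This is the p-th power of the positive part of log_a z; the change of base appears as a constant
    factor. *)
Definition log_power (z : \bar R) : \bar R := logplus z `^ p * (((ln a) `^ p)^-1)%R%:E.

Let lna0 : (0 < ln a)%R. Proof. exact: ln_gt0. Qed.

Lemma log_power_ge0 z : 0 <= log_power z.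
Proof. by rewrite mule_ge0 ?poweR_ge0// lee_fin invr_ge0 powR_ge0. Qed.

(** Translates superlevel sets of F into those of its log power, so that f_1(s^(1/p)) becomes the
    distribution function of the latter. For z <= 1 both sides are false, as a^(s^(1/p)) >= 1. *)
Lemma lt_log_power (s : R) z : (0 <= s)%R ->
  (s%:E < log_power z) = ((a `^ (s `^ p^-1))%:E < z).
Proof.
move=> s0; rewrite /log_power.
have c0 : (0 < ((ln a) `^ p)^-1)%R by rewrite invr_gt0 powR_gt0.
have as1 : (1 <= a `^ (s `^ p^-1))%R.
  by rewrite -(powRr0 a) ler_powR ?powR_ge0// ltW.
case: z => [r| |].
- have [r1|r1] := leP r 1%R.
    have -> : logplus r%:E = 0.
      apply/max_idPr; rewrite /lne; case: ifPn => // r0.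
      by rewrite lee_fin ln_le0.
    rewrite poweR0r ?gt_eqF// mul0e !lte_fin ltNge s0; apply/esym/negbTE.
    by rewrite -leNgt (le_trans r1).
  have r0 : (0 < r)%R by exact: lt_trans r1.
  rewrite /logplus lne_EFin// -EFin_max max_l ?ln_ge0 ?ltW//.
  rewrite poweR_EFin -EFinM !lte_fin ltr_pdivlMr ?powR_gt0//.
  have sE : (s * ln a `^ p = (s `^ p^-1 * ln a) `^ p)%R.
    by rewrite powRM ?powR_ge0 ?ltW// -powRrM mulVf ?gt_eqF// powRr1.
  have X0 : (0 <= ln (a `^ (s `^ p^-1)))%R by exact: ln_ge0.
  have Y0 : (0 <= ln r)%R by rewrite ln_ge0// ltW.
  rewrite sE -ln_powR -[RHS]ltr_ln ?posrE ?powR_gt0//; last exact: lt_trans a1.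
  apply/idP/idP; last exact: gt0_ltr_powR.
  apply: contraLR; rewrite -!leNgt => XY.
  by apply: ge0_ler_powR => //; exact: ltW.
- have -> : logplus +oo = +oo :> \bar R by exact/max_idPl/leey.
  by rewrite poweRyr ?gt_eqF// gt0_mulye// !ltry.
- have -> : logplus -oo = 0 :> \bar R by exact/max_idPr/leNye.
  by rewrite poweR0r ?gt_eqF// mul0e lte_fin ltNge s0.
Qed.

End loglevel.

(** * Hoelder's inequality for finite sums and a telescoping bound *)

Section series_estimates.
Context {R : realType}.

(** After dividing [f] by A^(1/p) and [g] by B^(1/q), Young's inequality holds term by term, and the
    right-hand sides add up to at most 1/p + 1/q = 1. *)
Lemma hoelder_sum_le (N : nat) (f g : nat -> R) (p q A B : R) :
  0 < p -> 0 < q -> p^-1 + q^-1 = 1 -> 0 < A -> 0 < B ->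
  (forall i, 0 <= f i) -> (forall i, 0 <= g i) ->
  \sum_(i < N) f i `^ p <= A -> \sum_(i < N) g i `^ q <= B ->
  \sum_(i < N) f i * g i <= A `^ p^-1 * B `^ q^-1.
Proof.
move=> p0 q0 pq A0 B0 f0 g0 fA gB.
have A1 : 0 < A `^ p^-1 by exact: powR_gt0.
have B1 : 0 < B `^ q^-1 by exact: powR_gt0.
have rootVK (x r : R) : 0 < x -> 0 < r -> ((x `^ r^-1)^-1) `^ r = x^-1.
  by move=> x0 r0; rewrite -powRN -powRrM mulNr mulVf ?gt_eqF// powR_inv1 ?ltW.
rewrite -[leRHS]mulr1 -ler_pdivrMl ?mulr_gt0// mulr_sumr.
apply: (@le_trans _ _ (\sum_(i < N) (f i `^ p / A / p + g i `^ q / B / q))).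
  apply: ler_sum => i _.
  rewrite invfM mulrACA (mulrC _ (f i)) (mulrC _ (g i)).
  have := @conjugate_powR R (f i / A `^ p^-1) (g i / B `^ q^-1) p q.
  rewrite !divr_ge0 ?powR_ge0// => /(_ isT isT p0 q0 pq) /le_trans; apply.
  by rewrite !powRM ?invr_ge0 ?powR_ge0// !rootVK.
rewrite big_split/= -!mulr_suml -pq lerD//.
  by rewrite ler_piMl ?invr_ge0 ?(ltW p0)// ler_pdivrMr// mul1r.
by rewrite ler_piMl ?invr_ge0 ?(ltW q0)// ler_pdivrMr// mul1r.
Qed.

(** Replaces the comparison with an integral over [s-1, s] by a difference that telescopes. With
    s^(-th) factored out it reads th/s <= (1 - 1/s)^(-th) - 1, which follows from e^v >= 1 + v and
    ln(1 - 1/s) <= -1/s. *)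
Lemma powRN1D_le (th s : R) : 0 < th -> 1 < s ->
  s `^ (- (1 + th)) <= th^-1 * ((s - 1) `^ (- th) - s `^ (- th)).
Proof.
move=> th0 s1.
have s0 : 0 < s by lra.
have q0 : 0 < 1 - s^-1 by rewrite subr_gt0 invf_lt1.
rewrite (_ : s - 1 = s * (1 - s^-1)); last by rewrite mulrBr mulfV ?gt_eqF// mulr1.
rewrite (powRM _ (ltW s0) (ltW q0)) -{2}(mulr1 (s `^ (- th))) -mulrBr.
rewrite opprD addrC powRD ?(gt_eqF s0) ?implybT// powR_inv1 ?(ltW s0)//.
rewrite mulrCA ler_wpM2l ?powR_ge0// ler_pdivlMl//.
rewrite lerBrDl /powR gt_eqF//; apply: le_trans (expR_ge1Dx _).
rewrite lerD2l mulNr -mulrN ler_pM2l//.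
by rewrite lerNr; apply: le_ln1Dx; rewrite ltrN2 invf_lt1.
Qed.

Lemma sum_powRN1D_le (th b : R) (N : nat) : 0 < th -> 1 < b ->
  \sum_(n < N) (b + n%:R) `^ (- (1 + th)) <= th^-1 * (b - 1) `^ (- th).
Proof.
move=> th0 b1.
apply: (@le_trans _ _ (th^-1 * ((b - 1) `^ (- th) - (b + N%:R - 1) `^ (- th)))).
  elim: N => [|N IH]; first by rewrite big_ord0 addr0 subrr mulr0.
  rewrite big_ord_recr/=; apply: le_trans (lerD IH (powRN1D_le th0 _)) _.
    by rewrite ltr_wpDr.
  by rewrite -mulrDr subrKA (_ : b + N.+1%:R - 1 = b + N%:R)// -natr1; ring.
by rewrite ler_wpM2l ?invr_ge0 ?(ltW th0)// gerBl powR_ge0.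
Qed.

End series_estimates.

(** * The function psi as a tail integral, and the weighted sum over level sets *)

Section psi.
Local Open Scope ereal_scope.
Context {R : realType} {k : nat}.
Variables (Omega : set 'rV[R]_k) (F : 'rV[R]_k -> \bar R) (a eps : R) (lam : nat).
Hypotheses (k1 : (2 <= k)%N) (oOmega : open Omega) (F_usc : usc_on Omega F).
Hypotheses (eps0 : (0 < eps)%R) (a1 : (1 < a)%R).

Let p : R := (k%:R - 1 + eps)%R.

Let k1R : (1 <= k%:R - 1 :> R)%R.
Proof. by rewrite lerBrDr (_ : 1 + 1 = 2%:R)%R// ler_nat. Qed.

Let p0 : (0 < p)%R.
Proof. by rewrite /p; have := k1R; have := eps0; lra. Qed.

Let G (y : borelV R k) := log_power a p (F y).

Let mOmega : measurable (Omega : set (borelV R k)).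
Proof. exact: open_borelV. Qed.

Lemma measurable_log_power : measurable_fun (Omega : set (borelV R k)) G.
Proof.
have mF := usc_measurable oOmega F_usc.
move=> mO; apply: (measurability _ (ErealGenOInfty.measurableE R)) => //.
move=> _ [_ [s ->] <-].
rewrite (_ : _ `&` _ = Omega `&` [set y | s%:E < G y]); last first.
  by apply/seteqP; split=> y; rewrite /= in_itv/= andbT.
(* The translation into superlevel sets of [F] covers s >= 0; for s < 0 the superlevel set is all of
   [Omega]. *)
have [s0|s0] := ltP s 0%R.
  rewrite (_ : _ `&` _ = Omega)//; apply/seteqP; split=> [y []//|y Oy]; split=> //=.
  by apply: lt_le_trans (log_power_ge0 a p _); rewrite lte_fin.
rewrite (_ : _ `&` _ = Omega `&` [set y | (a `^ (s `^ p^-1))%:E < F y]).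
  exact: emeasurable_fun_o_infty.
by apply/seteqP; split=> y; rewrite /= /G lt_log_power.
Qed.

(** For t > lam this is the set where F > a^(t-lam), phrased through [G] to match the layer-cake
    formula. *)
Definition high_set (t : R) : set (borelV R k) :=
  [set y | Omega y /\ ((t - lam%:R) `^ p)%:E < G y].

Lemma measurable_high_set t : measurable (high_set t).
Proof.
rewrite (_ : high_set t = Omega `&` [set y | ((t - lam%:R) `^ p)%:E < G y])//.
exact: (emeasurable_fun_o_infty mOmega measurable_log_power).
Qed.

Lemma measurable_log_power_high t : measurable_fun (high_set t) G.
Proof. by apply: (measurable_funS mOmega _ measurable_log_power) => y []. Qed.

(** The two summands in psi are those of the layer-cake formula for [G] with cutoff (t-lam)^p. *)
Lemma psiE t : (lam%:R < t)%R ->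
  psi Omega F a eps lam t = (\int[lebesgueV R k]_(y in high_set t) G y) `^ k%:R^-1.
Proof.
move=> lt; have c0 : (0 <= (t - lam%:R) `^ p)%R by exact: powR_ge0.
rewrite /psi /high_set -(layer_cake_tail _ mOmega measurable_log_power c0).
congr ((_ + _) `^ _).
- apply: eq_integral => s; rewrite inE /= in_itv/= andbT => cs.
  rewrite /f1 /distribution_fun; congr (lebesgueV R k _).
  by apply/seteqP; split=> y /=; rewrite lt_log_power// (le_trans c0).
- congr (_ * _); rewrite /f1 /distribution_fun; congr (lebesgueV R k _).
  have tE : (t - lam%:R = ((t - lam%:R) `^ p) `^ p^-1)%R.
    by rewrite -powRrM mulfV ?gt_eqF// powRr1 // subr_ge0 ltW.
  by apply/seteqP; split=> y /=; rewrite lt_log_power// -tE.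
Qed.

Lemma integral_high_set_le t :
  \int[lebesgueV R k]_(y in high_set t) G y <=
  \int[lebesgueV R k]_(y in Omega) G y.
Proof.
apply: ge0_subset_integral => //.
- exact: measurable_high_set.
- exact: measurable_log_power.
- by move=> y _; exact: log_power_ge0.
- by move=> y [].
Qed.

Lemma integral_log_power_lty :
  \int[lebesgueV R k]_(y in Omega) (logplus (F y) `^ p) < +oo ->
  \int[lebesgueV R k]_(y in Omega) G y < +oo.
Proof.
have c0 : (0 < (ln a `^ p)^-1)%R by rewrite invr_gt0 powR_gt0// ln_gt0.
have GE y : logplus (F y) `^ p = ((ln a `^ p)%R)%:E * G y.
  rewrite /G /log_power muleCA -EFinM divff ?mule1// gt_eqF//.
  by rewrite -invr_gt0.
under eq_integral do rewrite GE.
rewrite ge0_integralZl_EFin//; last 3 first.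
- by move=> y _; exact: log_power_ge0.
- exact: measurable_log_power.
- exact: powR_ge0.
have d0 : 0 < (ln a `^ p)%:E by rewrite lte_fin -invr_gt0.
by case: (\int[_]_(y in _) G y) => [r _| |//]; rewrite ?ltry// gt0_muley.
Qed.

(** On the n-th level set F >= u > a^(t+n-lam), so the weight (t+n-lam)^p is below [G] there. All
    level sets lie in [high_set t], and each point belongs to at most lam+1 of them. *)
Lemma sum_level_le (u : 'rV[R]_k -> \bar R) (t : R) (N : nat) : (lam%:R < t)%R ->
  subharmonic Omega u -> (forall y, Omega y -> u y <= F y) ->
  \sum_(n < N) ((t + n%:R - lam%:R) `^ p)%:E *
    lebesgueV R k (level Omega u (a `^ (t + n%:R - lam%:R))%:E (a `^ (t + n%:R + 1))%:E)
  <= lam.+1%:R%:E * \int[lebesgueV R k]_(y in high_set t) G y.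
Proof.
move=> lt su uF.
pose L (n : nat) := level Omega u (a `^ (t + n%:R - lam%:R))%:E (a `^ (t + n%:R + 1))%:E.
pose c (n : nat) := ((t + n%:R - lam%:R) `^ p)%R.
have mL n : measurable (L n) by exact: measurable_level.
have c0 n : (0 <= c n)%R by exact: powR_ge0.
have tl n : (t - lam%:R <= t + n%:R - lam%:R)%R by rewrite lerD2r lerDl.
have t0 : (0 < t - lam%:R)%R by rewrite subr_gt0.
have cG n y : L n y -> (c n)%:E < G y.
  move=> [Oy /andP[uy _]]; rewrite /G lt_log_power// -powRrM mulfV ?gt_eqF//.
  rewrite powRr1 ?(le_trans (ltW t0))//.
  exact: lt_le_trans uy (uF _ Oy).
have LB n : L n `<=` high_set t.
  move=> y Ly; split; first by case: Ly.
  apply: le_lt_trans (cG n y Ly); rewrite lee_fin ge0_ler_powR ?nnegrE ?(ltW p0)//.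
    exact: ltW.
  by rewrite (le_trans (ltW t0)).
have mH := measurable_high_set t.
rewrite (eq_bigr (fun n : 'I_N => \int[lebesgueV R k]_(y in high_set t)
    ((c n)%:E * (\1_(L n) y)%:E))); last first.
  move=> n _; rewrite ge0_integralZl_EFin//; last exact/measurable_EFinP.
  by rewrite integral_indic// setIidl.
rewrite -ge0_integral_sum//; last 2 first.
- by move=> n; apply/measurable_EFinP; exact: measurable_funM.
- by move=> n y _; rewrite -EFinM lee_fin mulr_ge0.
rewrite -ge0_integralZl//; last 2 first.
- exact: measurable_log_power_high.
- by move=> y _; exact: log_power_ge0.
apply: ge0_le_integral => //.
- by move=> y _; apply: sume_ge0 => n _; rewrite -EFinM lee_fin mulr_ge0.
- by apply: emeasurable_sum => n; apply/measurable_EFinP; exact: measurable_funM.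
- by apply: measurable_funeM; exact: measurable_log_power_high.
move=> y [Oy cy].
case E : (G y) => [r| |]; last 2 first.
- by rewrite gt0_muley ?leey// lte_fin.
- by rewrite E in cy.
rewrite sumEFin -EFinM lee_fin.
have r0 : (0 <= r)%R by rewrite -lee_fin -E; exact: log_power_ge0.
apply: (@le_trans _ _ (\sum_(n < N | y \in L n) r)%R).
  rewrite [leRHS]big_mkcond; apply: ler_sum => n _.
  rewrite indicE; case: ifPn => [/set_mem Ly|_]; last by rewrite mulr0.
  by rewrite mulr1; have := cG _ _ Ly; rewrite E lte_fin => /ltW.
rewrite sumr_const -[leLHS]mulr_natl ler_wpM2r// ler_nat -sum1_card.
apply: (@count_close lam N (fun n => y \in L n)) => m n.
move=> /set_mem[_ /andP[_ um]] /set_mem[_ /andP[un _]].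
(* A common point of the m-th and n-th sets gives a^(t+n-lam) < a^(t+m+1), so n < m + lam + 1, that
   is n <= m + lam. *)
have := lt_le_trans un um; rewrite lte_fin => h.
rewrite -ltnS -(ltr_nat R) -natr1 natrD.
suff : (t + n%:R - lam%:R < t + m%:R + 1)%R by lra.
by rewrite ltNge; apply/negP => /(ler_powR (ltW a1)); rewrite leNgt h.
Qed.

End psi.

(** * Domar's iteration *)

Section iteration.
Context {R : realType} {k : nat}.
Variables (Omega : set 'rV[R]_k) (u : 'rV[R]_k -> \bar R).
Hypotheses (k0 : (0 < k)%N) (oOmega : open Omega) (su : subharmonic Omega u).
Variables (a D : R) (lam : nat).
Hypotheses (a1 : 1 < a) (D0 : 0 < D)
  (hD : a / (D ^+ k * unit_ball_volume R k) + (a ^+ lam)^-1 <= 1).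

(** At a cluster point z the value +oo is excluded, so u(z) < c for some real c, and upper
    semicontinuity extends this to a neighbourhood of z. The sequence returns there at arbitrarily
    late indices, where u >= c. *)
Lemma subharmonic_bounded_seq (K : set 'rV[R]_k) (y : nat -> 'rV[R]_k) (t : R) :
  compact K -> K `<=` Omega -> (forall n, K (y n)) ->
  ~ (forall n, ((a `^ (t + n%:R))%:E <= u (y n))%E).
Proof.
move=> cK KO Ky uy.
have yK : (y @ \oo) K by exists 0 => // n _; exact: Ky.
have [z [Kz clz]] := cK _ _ yK.
have Oz := KO _ Kz.
have [uz usc_u _] := su.
have [c zc] : exists c : R, (u z < c%:E)%E.
  have := uz _ Oz; case: (u z) => [r _| //|_]; last by exists 0; exact: ltNy0.
  by exists (r + 1); rewrite lte_fin ltrDl.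
have [N aN] : exists N : nat, c <= a `^ (t + N%:R).
  have la0 : 0 < ln a by rewrite ln_gt0.
  (* Since a^w >= 1 + w ln a, every N >= v satisfies a^(t+N) >= c. *)
  pose v := (c - 1) / ln a - t.
  exists (Num.bound `|v|).
  have vN : v <= (Num.bound `|v|)%:R.
    exact: le_trans (ler_norm v) (ltW (archi_boundP (normr_ge0 v))).
  rewrite /powR gt_eqF ?(lt_trans _ a1)//; apply: le_trans (expR_ge1Dx _).
  by rewrite -lerBlDl -ler_pdivrMr// -lerBlDl.
have nz : nbhs z (Omega `&` [set y | u y < c%:E]%E).
  by apply: open_nbhs_nbhs; split => //; exact: usc_sublevel_open.
have yN : (y @ \oo) [set y n | n in [set n | (N <= n)%N]].
  by exists N => // n Nn; exists n.
have [_ [[n /= Nn <-] [_ /= uyn]]] := clz _ _ yN nz.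
have := le_lt_trans (uy n) uyn; rewrite lte_fin ltNge => /negP; apply.
apply: le_trans aN _; rewrite ler_powR ?(ltW a1)// lerD2l ler_nat//.
Qed.

Lemma domar_iteration (x : 'rV[R]_k) (t d sigma : R) (m : nat -> R) :
  (forall n, lebesgueV R k (level Omega u (a `^ (t + n%:R - lam%:R))%:E
    (a `^ (t + n%:R + 1))%:E) = (m n)%:E) ->
  (forall r, r < d -> closed_eball x r `<=` Omega) ->
  (forall N, \sum_(n < N) D * (m n) `^ k%:R^-1 <= sigma) -> sigma < d ->
  (u x < (a `^ t)%:E)%E.
Proof.
move=> mE BO Ssigma sd; rewrite ltNge; apply/negP => ux.
pose eta := (d - sigma) / 2.
have eta0 : 0 < eta by rewrite divr_gt0// subr_gt0.
(* The geometric term keeps the radius positive when m_n = 0 and makes D^k m_n < r_n^k strict. All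
   these terms together cost at most [eta], half of the gap between [sigma] and [d]. *)
pose r n := D * (m n) `^ k%:R^-1 + eta / 2 ^+ n.+1.
have m0 n : 0 <= m n by rewrite -lee_fin -mE; exact: measure_ge0.
have r0 n : 0 < r n.
  by rewrite ltr_wpDl ?mulr_ge0 ?powR_ge0 ?(ltW D0)// divr_gt0// exprn_gt0.
have Sr N : \sum_(n < N) r n <= sigma + eta.
  rewrite big_split/= lerD ?Ssigma//.
  rewrite (_ : \sum_(_ < _) _ = eta * (1 - 2 ^- N)).
    by rewrite ler_piMr ?(ltW eta0)// gerBl invr_ge0 exprn_ge0.
  elim: N => [|N IH]; first by rewrite big_ord0 expr0 invr1 subrr mulr0.
  rewrite big_ord_recr/= IH exprS; field.
  by rewrite expf_neq0.
have rho_lt : sigma + eta < d by rewrite /eta; lra.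
(* Invariant: the n-th point stays within r_0 + ... + r_(n-1) of [x], and the lower bound for u
   gains a factor [a] at each step. *)
have step n : exists y,
    closed_eball x (\sum_(i < n) r i) y /\ ((a `^ (t + n%:R))%:E <= u y)%E.
  elim: n => [|n [y [xy uy]]].
    by exists x; rewrite big_ord0 addr0 /closed_eball /=;
    rewrite subrr -(scale0r 0) enormZ normr0 mul0r.
  have sub : closed_eball y (r n) `<=` closed_eball x (\sum_(i < n.+1) r i).
    move=> z yz; rewrite big_ord_recr /closed_eball /= -(subrK y z) -addrA addrC.
    exact: le_trans (enormD _ _) (lerD xy yz).
  have yO : closed_eball y (r n) `<=` Omega.
    by apply: subset_trans sub _; apply: BO; exact: le_lt_trans rho_lt.
  have [|z yz uz] := subharmonic_larger_value oOmega su D0 a1 hD (r0 n) yO uy.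
    rewrite mE -EFinM lte_fin.
    rewrite (_ : D ^+ k * m n = (D * (m n) `^ k%:R^-1) ^+ k).
      rewrite ltrXn2r -?lt0n ?k0// ?mulr_ge0 ?powR_ge0 ?(ltW D0)// ltrDl.
      by rewrite divr_gt0// exprn_gt0.
    rewrite exprMn -[X in _ = _ * X]powR_mulrn ?powR_ge0// -powRrM
      mulVf ?pnatr_eq0 ?gt_eqF//.
    by rewrite powRr1.
  exists z; split; first by apply: sub; exact: ltW.
  by rewrite -natr1 addrA ltW.
have [y yP] := choice step.
apply: (@subharmonic_bounded_seq (closed_eball x (sigma + eta)) y t).
- exact: compact_closed_eball.
- exact: BO.
- by move=> n; apply: le_trans (Sr n); have [] := yP n.
- by move=> n; have [] := yP n.
Qed.

End iteration.

(** * Distance to the boundary *)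

Section boundary_distance.
Context {R : realType} {k : nat}.
Variables (Omega : set 'rV[R]_k) (x : 'rV[R]_k).
Hypotheses (oOmega : open Omega) (Ox : Omega x).

Let has_lbound_dist : has_lbound [set enorm (x - y) | y in boundary Omega].
Proof. by exists 0 => _ [y _ <-]; exact: enorm_ge0. Qed.

(** The segment from [x] to a point of the ball outside [Omega] would yield a boundary point at
    distance at most [r]. *)
Lemma closed_eball_sub_edist (r : R) : r < edist_set x (boundary Omega) ->
  closed_eball x r `<=` Omega.
Proof.
move=> rd y yr; apply: contrapT => nOy.
have [z bz xz] := segment_meets_boundary oOmega Ox nOy.
have := ge_inf has_lbound_dist (ex_intro2 _ _ z bz erefl).
apply/negP; rewrite -ltNge; apply: le_lt_trans rd; apply: le_trans xz _.
by rewrite enorm_distC.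
Qed.

(** The infimum of the empty set is 0, so the boundary must first be shown nonempty: a vector with
    large coordinates lies outside [Omega], and the segment to it yields a boundary point. A
    sup-norm ball around [x] inside [Omega] then bounds all distances from below. *)
Lemma edist_boundary_gt0 : (0 < k)%N -> bounded_set Omega ->
  0 < edist_set x (boundary Omega).
Proof.
move=> k0 [M [_ MO]].
have [e /= e0 eO] : nbhs_ball x Omega.
  by apply/nbhs_ballP; exact: open_nbhs_nbhs.
apply: (lt_le_trans e0); apply: lb_le_inf.
  pose y : 'rV[R]_k := const_mx (`|M| + 2).
  have nOy : ~ Omega y.
    move=> /(MO (`|M| + 1)) /=.
    have -> : M < `|M| + 1 by rewrite ltr_pwDr// ler_norm.
    move=> /(_ isT); apply/negP; rewrite -ltNge.
    apply: (@lt_le_trans _ _ `|y ord0 (Ordinal k0)|).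
      by rewrite mxE [ltRHS]ger0_norm ?addr_ge0// ltrD2l ltr1n.
    by rewrite [leRHS]/Num.norm /= mx_normrE; apply/bigmax_geP; right => /=;
    exists (ord0, Ordinal k0).
  have [z bz _] := segment_meets_boundary oOmega Ox nOy.
  by exists (enorm (x - z)); exists z.
move=> _ [z [_ nOz] <-]; rewrite leNgt; apply/negP => xz.
apply: nOz; move: oOmega; rewrite openE; apply; apply: eO.
by rewrite -ball_normE /=; apply: le_lt_trans xz; exact: normr_le_enorm.
Qed.

End boundary_distance.

(** * Finiteness, decay and positivity for phi, and the sum of the radii *)

Section phi.
Context {R : realType} {k : nat}.
Variables (Omega : set 'rV[R]_k) (F : 'rV[R]_k -> \bar R) (a eps : R) (lam : nat).
Hypotheses (k1 : (2 <= k)%N) (oOmega : open Omega) (F_usc : usc_on Omega F).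
Hypotheses (eps0 : 0 < eps) (a1 : 1 < a).
Hypothesis F_int : (\int[lebesgueV R k]_(x in Omega)
  (logplus (F x) `^ (k%:R - 1 + eps)) < +oo)%E.

Let p : R := k%:R - 1 + eps.
Let k1R : 1 <= k%:R - 1 :> R.
Proof. by rewrite lerBrDr (_ : 1 + 1 = 2%:R)%R// ler_nat. Qed.
Let k0R : 0 < k%:R :> R. Proof. by have := k1R; lra. Qed.

Definition tail_integral (t : R) : R :=
  fine (\int[lebesgueV R k]_(y in high_set Omega F a eps lam t) log_power a p (F y)).

Lemma tail_integralE t :
  (\int[lebesgueV R k]_(y in high_set Omega F a eps lam t) log_power a p (F y))%E =
  (tail_integral t)%:E.
Proof.
rewrite /tail_integral fineK// ge0_fin_numE; last first.
  by apply: integral_ge0 => y _; exact: log_power_ge0.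
apply: le_lt_trans (integral_log_power_lty k1 oOmega F_usc eps0 a1 F_int).
exact: integral_high_set_le.
Qed.

Lemma tail_integral_ge0 t : 0 <= tail_integral t.
Proof. by apply/fine_ge0/integral_ge0 => y _; exact: log_power_ge0. Qed.

Lemma phiE t : lam%:R < t ->
  phi Omega F a eps lam t =
    (@delta R k eps lam t * (tail_integral t) `^ k%:R^-1)%:E.
Proof. by move=> lt; rewrite /phi psiE// tail_integralE poweR_EFin. Qed.

(** Makes the set defining [phi_inv] nonempty, so that its infimum is not the default value. It
    holds because psi is bounded by the full integral over [Omega] while delta decays to 0. *)
Lemma phi_small (s : R) : 0 < s ->
  exists t, lam%:R + 1 < t /\ (phi Omega F a eps lam t <= s%:E)%E.
Proof.
move=> s0.
have := integral_log_power_lty k1 oOmega F_usc eps0 a1 F_int.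
set I := (\int[_]_(y in _) _)%E => Iy.
have I0 : (0 <= I)%E by apply: integral_ge0 => y _; exact: log_power_ge0.
have IE : I = (fine I)%:E by rewrite fineK// ge0_fin_numE.
pose K := (lam%:R + 1) * ((k%:R - 1) / eps) `^ ((k%:R - 1) / k%:R).
have K0 : 0 <= K by rewrite mulr_ge0 ?powR_ge0// addr_ge0.
(* The point t = lam + 1 + Q^(k/eps) makes delta(t) equal to K/Q, and Q s >= K I^(1/k) by this
   choice; the added 1 keeps [Q] positive. *)
pose Q := K * fine I `^ k%:R^-1 / s + 1.
have Q0 : 0 < Q by rewrite ltr_wpDl// divr_ge0 ?(ltW s0)// mulr_ge0// powR_ge0.
exists (lam%:R + 1 + Q `^ (k%:R / eps)).
have lt1 : lam%:R + 1 < lam%:R + 1 + Q `^ (k%:R / eps) by rewrite ltrDl powR_gt0.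
split=> //; rewrite phiE; last by apply: lt_trans lt1; rewrite ltrDl.
rewrite lee_fin /delta (_ : _ - 1 - _ = Q `^ (k%:R / eps)); last by ring.
rewrite -powRrM (_ : _ * (eps / _) = 1); last first.
  by field; rewrite ?gt_eqF.
rewrite powRr1 ?(ltW Q0)// -/K mulrAC ler_pdivrMr//.
set t := lam%:R + 1 + _.
have tI : tail_integral t <= fine I.
  by rewrite -lee_fin -tail_integralE -IE; exact: integral_high_set_le.
have fI0 : 0 <= fine I by exact: fine_ge0.
apply: (@le_trans _ _ (K * fine I `^ k%:R^-1)).
  apply: ler_wpM2l K0 _ _ _; apply: ge0_ler_powR tI; last exact: fI0.
    by rewrite invr_ge0 ltW.
  by rewrite nnegrE tail_integral_ge0.
by rewrite /Q mulrDr mulr1 mulrCA mulfV ?gt_eqF// mulr1 lerDl ltW.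
Qed.

(** The second layer-cake term, (t-lam)^p m{F > a^(t-lam)}, is already positive. *)
Lemma tail_integral_gt0 t : lam%:R < t ->
  (0 < lebesgueV R k [set y | Omega y /\ ((a `^ (t - lam%:R))%:E < F y)%E])%E ->
  0 < tail_integral t.
Proof.
move=> lt Fpos.
have c0 : 0 < (t - lam%:R) `^ p by rewrite powR_gt0// subr_gt0.
have p0 : 0 < p by rewrite /p; have := k1R; have := eps0; lra.
rewrite -lte_fin -tail_integralE.
rewrite -(layer_cake_tail (lebesgueV R k) (open_borelV oOmega)
  (measurable_log_power k1 oOmega F_usc eps0 a1) (ltW c0)).
apply: (@lt_le_trans _ _ (((t - lam%:R) `^ p)%:E *
    lebesgueV R k [set y | Omega y /\ ((a `^ (t - lam%:R))%:E < F y)%E])%E).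
  by rewrite mule_gt0.
rewrite (_ : [set y | _] =
    [set y | Omega y /\ (((t - lam%:R) `^ p)%:E < log_power a p (F y))%E]).
  by rewrite leeDr// integral_ge0.
by apply/seteqP; split=> y /=; rewrite lt_log_power ?(ltW c0)// -powRrM
  mulfV ?gt_eqF// powRr1// subr_ge0 ltW.
Qed.

(** Hoelder with exponents k/(k-1) and k: the inverse weights sum to the power of t - 1 - lam in
    delta, the weighted measures to psi. The overlap costs only (lam+1)^(1/k), whereas delta carries
    the full factor lam+1, whence the prefactor. *)
Lemma sum_radii_le (u : 'rV[R]_k -> \bar R) (t : R) (m : nat -> R) (N : nat) :
  lam%:R + 1 < t -> 0 < tail_integral t ->
  subharmonic Omega u -> (forall y, Omega y -> u y <= F y)%E ->
  (forall n, lebesgueV R k (level Omega u (a `^ (t + n%:R - lam%:R))%:E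
    (a `^ (t + n%:R + 1))%:E) = (m n)%:E) ->
  \sum_(n < N) (m n) `^ k%:R^-1 <=
    lam.+1%:R `^ k%:R^-1 / lam.+1%:R *
      (@delta R k eps lam t * (tail_integral t) `^ k%:R^-1).
Proof.
move=> lt X0 su uF mE.
have ltt : lam%:R < t by apply: lt_trans lt; rewrite ltrDl.
have k10 : 0 < k%:R - 1 :> R by exact: lt_le_trans k1R.
pose th := eps / (k%:R - 1).
have th0 : 0 < th by exact: divr_gt0.
pose b := t - lam%:R.
have b1 : 1 < b by rewrite /b ltrBrDl.
have m0 n : 0 <= m n by rewrite -lee_fin -mE; exact: measure_ge0.
have bn n : 0 < b + n%:R by rewrite ltr_wpDr// (lt_trans _ b1).
(* Raised to the power k/(k-1), this has exponent -p/(k-1) = -(1 + th), as the telescoping bound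
   requires. *)
pose f n := (b + n%:R) `^ (- (p / k%:R)).
pose g n := ((b + n%:R) `^ p * m n) `^ k%:R^-1.
have fgE n : m n `^ k%:R^-1 = f n * g n.
  rewrite /f /g powRM ?powR_ge0// mulrA -powRrM -powRD ?addNr ?powRr0 ?mul1r//.
  by rewrite (gt_eqF (bn n)) implybT.
under eq_bigr do rewrite fgE.
have fA : \sum_(n < N) f n `^ (k%:R / (k%:R - 1)) <= th^-1 * (b - 1) `^ (- th).
  apply: le_trans (sum_powRN1D_le N th0 b1); apply: ler_sum => n _.
  rewrite /f -powRrM (_ : _ * _ = - (1 + th))// /th /p.
  by field; rewrite !gt_eqF.
have gB : \sum_(n < N) g n `^ k%:R <= lam.+1%:R * tail_integral t.
  rewrite -lee_fin EFinM -tail_integralE.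
  apply: le_trans (sum_level_le k1 oOmega F_usc eps0 a1 N ltt su uF).
  rewrite -sumEFin lee_sum// => n _; rewrite mE -EFinM lee_fin /g.
  rewrite -powRrM mulVf ?gt_eqF// powRr1 ?mulr_ge0 ?powR_ge0//.
  by rewrite /b addrAC.
have A0 : 0 < th^-1 * (b - 1) `^ (- th).
  by rewrite mulr_gt0 ?invr_gt0// powR_gt0// subr_gt0.
have B0 : 0 < lam.+1%:R * tail_integral t by rewrite mulr_gt0.
have pq : (k%:R / (k%:R - 1))^-1 + k%:R^-1 = 1 :> R by field; rewrite !gt_eqF.
apply: le_trans (hoelder_sum_le (divr_gt0 k0R k10) k0R pq A0 B0 _ _ fA gB) _.
- by move=> n; exact: powR_ge0.
- by move=> n; exact: powR_ge0.
rewrite !powRM ?powR_ge0 ?invr_ge0 ?(ltW th0) ?tail_integral_ge0//.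
rewrite /th !invf_div -powRrM (_ : - _ * _ = - (eps / k%:R)); last first.
  by field; rewrite !gt_eqF.
rewrite powRN /delta (_ : b - 1 = t - 1 - lam%:R); last by rewrite /b; ring.
rewrite natr1 !mulrA.
rewrite divfK ?pnatr_eq0//.
by rewrite le_eqVlt; apply/orP; left; apply/eqP; ring.
Qed.

End phi.

(** * The bound for each subharmonic minorant at a point of the domain *)

Theorem theorem4p4 (R : realType) (k : nat) (hk : (2 <= k)%N)
    (Omega : set 'rV[R]_k) (hOmega : bounded_domain Omega)
    (F : 'rV[R]_k -> \bar R)
    (F_ge0 : forall x, Omega x -> (0 <= F x)%E)
    (F_usc : usc_on Omega F)
    (F_pos : forall s : R,
      (0 < lebesgueV R k [set x | Omega x /\ (s%:E < F x)%E])%E)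
    (eps : R) (eps_gt0 : 0 < eps)
    (F_int : (\int[lebesgueV R k]_(x in Omega)
                (logplus (F x) `^ (k%:R - 1 + eps)) < +oo)%E)
    (a : R) (a_gt1 : 1 < a)
    (D : R) (D_gt0 : 0 < D)
    (lam : nat) (lam_gt0 : (0 < lam)%N)
    (hD : a / (D ^+ k * unit_ball_volume R k) + (a ^+ lam)^-1 <= 1)
    (x : 'rV[R]_k) (hx : Omega x) :
  (upper_envelope Omega F x <=
    (a `^ phi_inv Omega F a eps lam
            (D^-1 * edist_set x (boundary Omega)))%:E)%E.
Proof.
have [_ oOmega _ bOmega] := hOmega.
have k0 : (0 < k)%N by exact: ltn_trans hk.
set d := edist_set x (boundary Omega).
have d0 : 0 < d by exact: edist_boundary_gt0.
have s0 : 0 < D^-1 * d by rewrite mulr_gt0 ?invr_gt0.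
have T0 := phi_small lam hk oOmega F_usc eps_gt0 a_gt1 F_int s0.
apply: ge_ereal_sup => _ [u [su uF] <-].
apply: contrapT => /negP; rewrite -ltNge => ux.
pose T := [set t | lam%:R + 1 < t /\ (phi Omega F a eps lam t <= (D^-1 * d)%:E)%E].
rewrite /phi_inv -/T in ux.
(* Writing u(x) = a^w, the strict inequality inf T < w leaves some t of [T] below w, which stands in
   for the infimum. *)
have [t [[lt phit]] ut] : exists t, T t /\ ((a `^ t)%:E <= u x)%E.
  have [ux_fin _ _] := su; have := ux_fin _ hx; move: ux.
  case: (u x) => [r| //|//]; rewrite lte_fin => ar _.
  have la0 : 0 < ln a by exact: ln_gt0.
  have r0 : 0 < r by apply: lt_trans ar; rewrite powR_gt0// (lt_trans _ a_gt1).
  have aE : r = a `^ (ln r / ln a).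
    by rewrite /powR gt_eqF ?(lt_trans _ a_gt1)// mulfVK ?gt_eqF// lnK.
  have : inf T < ln r / ln a.
    by rewrite ltNge; apply/negP => /(ler_powR (ltW a_gt1)); rewrite -aE leNgt ar.
  move=> /(inf_lt T0)[t Tt tr]; exists t; split=> //.
  by rewrite lee_fin aE ler_powR// ltW.
move: ut; apply/negP; rewrite -ltNge.
have ltt : lam%:R < t by apply: lt_trans lt; rewrite ltrDl.
have X0 : 0 < tail_integral Omega F a eps lam t.
  exact: tail_integral_gt0.
pose L n := level Omega u (a `^ (t + n%:R - lam%:R))%:E (a `^ (t + n%:R + 1))%:E.
have mE n : lebesgueV R k (L n) = (fine (lebesgueV R k (L n)))%:E.
  rewrite fineK// ge0_fin_numE//.
  apply: (@le_lt_trans _ _ (lebesgueV R k Omega)).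
    apply: le_measure; rewrite ?inE; [exact: measurable_level|exact: open_borelV|].
    by move=> y [].
  by apply: lebesgueV_bounded => //; exact: open_borelV.
set phit0 := @delta R k eps lam t * (tail_integral Omega F a eps lam t) `^ k%:R^-1.
have phi0 : 0 < phit0.
  have k10 : 0 < k%:R - 1 :> R by rewrite subr_gt0 ltr1n.
  rewrite mulr_gt0 ?powR_gt0// divr_gt0 ?powR_gt0//; 
    last by rewrite -addrA -opprD subr_gt0 addrC.
  by rewrite mulr_gt0 ?powR_gt0 ?divr_gt0// ltr_wpDl.
have Dphi : D * phit0 <= d.
  by move: phit; rewrite phiE// lee_fin ler_pdivlMl.
pose c : R := lam.+1%:R `^ k%:R^-1 / lam.+1%:R.
(* As lam + 1 > 1 and k >= 2, the k-th root of lam + 1 is smaller than lam + 1. This turns D phi(t)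
   <= d into a total radius strictly below [d], as needed because only balls of radius less than [d]
   are known to lie in [Omega]. *)
have c1 : c < 1.
  rewrite ltr_pdivrMr// mul1r -ltr_ln ?posrE ?powR_gt0// ln_powR.
  by rewrite gtr_pMl ?ln_gt0 ?ltr1n// invf_lt1 ?ltr0n ?ltr1n.
apply: (@domar_iteration R k Omega u k0 oOmega su a D lam a_gt1 D_gt0 hD x t d
  (D * (c * phit0))).
- exact: mE.
- by move=> r; exact: closed_eball_sub_edist.
- move=> N; rewrite -mulr_sumr ler_pM2l//.
  exact: (sum_radii_le hk oOmega F_usc eps_gt0 a_gt1 F_int N lt X0 su uF mE).
- by apply: lt_le_trans Dphi; rewrite ltr_pM2l// gtr_pMl.
Qed.
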